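(* There is a universal constant $C>0$ such that the following holds. Let $\mathcal{X}$ be a finite-dimensional Euclidean space, let $\mathcal{H}\subset\mathbb{S}$ be a linear subspace of self-adjoint operators on $\mathcal{X}$ satisfying properties (i)–(iii) of the context, let $\mathcal{R}>0$, $\eta=\mathcal{R}$, $\delta>0$ and $K\in\mathbb{N}_0$. Let $g_0,\dots,g_K\in\mathcal{X}$ be the gradients observed by the Generalized Leon algorithm described in the context (each $g_k$ is arbitrary and may be chosen depending on $x_0,\dots,x_k$), and let $(x_0,\dots,x_K)$ be its output. Then $$\mathrm{Reg}_K\le C\Big[\delta\,\mathcal{R}\,\dim\mathcal{X}+\mathcal{R}\,\rho_*(g_0)+\mathcal{R}\,\big\|\sqrt{\mathbf{S}_K}\big\|_{\mathrm{tr}}\Big],$$ where $\mathrm{Reg}_K=\max_{x\in Q_{\mathcal{R}}}\sum_{k=0}^K\langle g_k,x_k-x\rangle$.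
   Context: $\mathcal{X}$ is a finite-dimensional real Euclidean space with inner product $\langle\cdot,\cdot\rangle$ and norm $\|\cdot\|$. $\mathbb{S}$ is the space of self-adjoint linear operators $\mathcal{X}\to\mathcal{X}$ with inner product $\langle\mathbf{A},\mathbf{B}\rangle=\mathrm{tr}(\mathbf{A}\mathbf{B}^* )$; $\mathbb{S}_{++}\subset\mathbb{S}$ is the set of positive definite operators; $\mathbf{I}$ is the identity operator. $\|\mathbf{A}\|_{\mathrm{tr}}=\mathrm{tr}\sqrt{\mathbf{A}\mathbf{A}^*}$ and $\|\mathbf{A}\|_{\mathrm{op}}=\max_{\|x\|\le1}\|\mathbf{A}x\|$ are the trace and operator norms. For $z\in\mathcal{X}$, $\mathbf{out}(z)\in\mathbb{S}$ is the rank-one operator $x\mapsto z\langle z,x\rangle$. $\mathrm{proj}_{\mathcal{H}}$ is the orthogonal projection of $\mathbb{S}$ onto $\mathcal{H}$. $\mathbb{N}_0$ is the set of non-negative integers. The linear subspace $\mathcal{H}\subset\mathbb{S}$ satisfies: (i) $\mathbf{I}\in\mathcal{H}$; (ii) $\mathbf{H}\mathbf{F}\mathbf{H}\in\mathcal{H}$ for all $\mathbf{H},\mathbf{F}\in\mathcal{H}$; (iii) $\mathrm{proj}_{\mathcal{H}}(\mathbf{H})\in\mathbb{S}_{++}$ for all $\mathbf{H}\in\mathbb{S}_{++}$. The norms $\rho,\rho_*$ on $\mathcal{X}$ are $\rho(x)=\big\|\sqrt{\mathrm{proj}_{\mathcal{H}}(\mathbf{out}(x))}\big\|_{\mathrm{op}}$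 and $\rho_*(x)=\big\|\sqrt{\mathrm{proj}_{\mathcal{H}}(\mathbf{out}(x))}\big\|_{\mathrm{tr}}$, and $Q_{\mathcal{R}}=\{x\in\mathcal{X}:\rho(x)\le\mathcal{R}\}$. Generalized Leon algorithm (parameters $\eta,\delta>0$): set $x_0=0\in\mathcal{X}$, $\mathbf{S}_{-1}=\delta^2\mathbf{I}$, $m_{-1}=0$. For $k=0,\dots,K$: observe $g_k\in\mathcal{X}$; set $m_k=m_{k-1}+g_k$; set $\mathbf{S}_k=\mathbf{S}_{k-1}+\mathrm{proj}_{\mathcal{H}}(\mathbf{out}(g_k))$; set $x_{k+1}=-\nabla\Psi_k^*(m_k)$, where $\Psi_k^*(m)=\eta\,\big\|\sqrt{\mathrm{proj}_{\mathcal{H}}(\mathbf{out}(m))+\mathbf{S}_k}\big\|_{\mathrm{tr}}$ is a differentiable function of $m\in\mathcal{X}$ (with $\mathbf{S}_k$ held fixed). Output $(x_0,\dots,x_K)$. *)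

(* Defs.v *)
From mathcomp Require Export all_boot all_order all_algebra.
From mathcomp Require Export sesquilinear.
From mathcomp Require Export all_classical all_reals ereal.

Set Implicit Arguments.
Unset Strict Implicit.
Unset Printing Implicit Defensive.

Import Order.TTheory GRing.Theory Num.Theory.

Local Open Scope classical_set_scope.
Local Open Scope ring_scope.

(* A finite-dimensional Euclidean space is a [vectType] over the reals with a
   positive definite symmetric form; operators on it are elements of ['End(X)].
   The objects that textbooks introduce by unique existence (adjoint, square
   root, orthogonal projection, gradient) are picked by [xget], with default
   value 0 where no such object exists. *)
Section Euclidean.
Context {R : realType} {X : vectType R} (dot : {dot X for @idfun R}).
Implicit Types (A B F P : 'End(X)) (H : {vspace 'End(X)}) (x y z m v : X).

Definition enorm x : R := Num.sqrt (dot x x).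

Definition self_adjoint A : Prop := forall x y, dot (A x) y = dot x (A y).

Definition pos_semidef A : Prop :=
  self_adjoint A /\ forall x, 0 <= dot (A x) x.

Definition pos_def A : Prop :=
  self_adjoint A /\ forall x, x != 0 -> 0 < dot (A x) x.

Definition adjoint A : 'End(X) :=
  xget 0 [set B : 'End(X) | forall x y, dot (A x) y = dot x (B y)].

Definition lftrace A : R :=
  \tr (passmx.mxof (vbasis (@fullv R X)) (vbasis (@fullv R X)) A).

Definition opdot A B : R := lftrace (A \o adjoint B)%VF.

Definition lfsqrt A : 'End(X) :=
  xget 0 [set B : 'End(X) | pos_semidef B /\ (B \o B)%VF = A].

Definition trace_norm A : R := lftrace (lfsqrt (A \o adjoint A)%VF).

Definition op_norm A : R := sup [set enorm (A x) | x in [set x | enorm x <= 1]].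

Definition out z : 'End(X) := linfun (fun x => dot z x *: z).

Definition proj H A : 'End(X) :=
  xget 0 [set P : 'End(X) | P \in H /\ forall F, F \in H -> opdot (A - P) F = 0].

Definition rho H x : R := op_norm (lfsqrt (proj H (out x))).

Definition rho_star H x : R := trace_norm (lfsqrt (proj H (out x))).

Definition rho_ball H (r : R) : set X := [set x | rho H x <= r].

(* Frechet differentiability written out for [enorm], since a bare [vectType]
   carries no topology. *)
Definition is_gradient (f : X -> R) m v : Prop :=
  forall e : R, 0 < e -> exists2 d : R, 0 < d &
    forall h : X, enorm h < d -> `|f (m + h) - f m - dot v h| <= e * enorm h.

Definition gradient (f : X -> R) m : X := xget 0 [set v : X | is_gradient f m v].

(* The recursions start at index -1, so [leon_m] and [leon_S] are shifted by
   one: [leon_m g k] is m_(k-1) and [leon_S delta H g k] is S_(k-1), while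
   [leon_x eta delta H g k] is x_k. *)
Fixpoint leon_m (g : nat -> X) (k : nat) : X :=
  if k is j.+1 then leon_m g j + g j else 0.

Fixpoint leon_S (delta : R) H (g : nat -> X) (k : nat) : 'End(X) :=
  if k is j.+1 then leon_S delta H g j + proj H (out (g j))
  else (delta ^+ 2) *: \1%VF.

Definition leon_Psi (eta : R) H A m : R :=
  eta * trace_norm (lfsqrt (proj H (out m) + A)).

Definition leon_x (eta delta : R) H (g : nat -> X) (k : nat) : X :=
  if k is j.+1 then
    - gradient (leon_Psi eta H (leon_S delta H g j.+1)) (leon_m g j.+1)
  else 0.

(* Valued in the extended reals, so that an unbounded set would give [+oo]
   rather than the junk value of the real [sup]. *)
Definition regret (Q : set X) (g x : nat -> X) (K : nat) : \bar R :=
  ereal_sup [set (\sum_(k < K.+1) dot (g k) (x k - y))%:E | y in Q].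

End Euclidean.

(* Main.v *)
From HB Require Import structures.
From mathcomp Require Import complex ring lra.
Require Import Defs.

Set Implicit Arguments.
Unset Strict Implicit.
Unset Printing Implicit Defensive.

Import Order.TTheory GRing.Theory Num.Theory.
Import passmx.

Local Open Scope ring_scope.

(** Write [phi x] for [proj H (out x)], [S'] for [S + phi g], and
    [A := phi m + S = B^2], [A' := phi m + S' = B'^2] for the state before and
    after receiving [g].  Since [H] is closed under polynomials of its elements,
    it contains square roots and inverses, and [tr (F phi x) = <F x, x>] for [F]
    in [H].  Expanding [tr (B^-1 (Y - B)^2)] for positive [Y] shows that [tr sqrt]
    is concave with supergradient [B^-1 / 2], and that
    [m |-> tr (sqrt (phi m + S))] has gradient [B^-1 m].

    The potential [Psi_k (m_k)] cannot be linearized at [A], as [g] may be large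
    compared with [A].  Linearizing at [A'] instead costs [tr B' - tr B],
    [<B'^-1 g, g> / 2] and the cross term
    [<(B'^-1 - B^-1) m, g> = - <(B' - B) B^-1 m, B'^-1 g>].  The last one is at
    most [tr (B' - B)], because [phi (B^-1 m)] and [phi (B'^-1 g)] are at most the
    identity and [B' - B] is positive.  Operator monotonicity of the square root
    bounds everything by multiples of
    [<S'^(-1/2) g, g> <= 2 (tr (sqrt S') - tr (sqrt S))], which telescopes.
    This gives the theorem with [C = 5]. *)

(** * Polynomials in an endomorphism *)

Section LfunPoly.
Context {R : fieldType} {X : vectType R}.
Implicit Types (A B : 'End(X)) (p q : {poly R}).

Definition lfpow A k : 'End(X) := iter k (comp_lfun A) \1%VF.

Definition lfpoly A p : 'End(X) := \sum_(i < size p) p`_i *: lfpow A i.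

Lemma lfpoly_wide A p n : (size p <= n)%N ->
  lfpoly A p = \sum_(i < n) p`_i *: lfpow A i.
Proof.
move=> le_n; rewrite /lfpoly (big_ord_widen _ (fun i => p`_i *: lfpow A i) le_n).
rewrite big_mkcond; apply: eq_bigr => i _; case: ltnP => // le_i.
by rewrite nth_default // scale0r.
Qed.

Lemma lfpolyD A p q : lfpoly A (p + q) = lfpoly A p + lfpoly A q.
Proof.
have le_p := leq_maxl (size p) (size q); have le_q := leq_maxr (size p) (size q).
rewrite (lfpoly_wide A (size_polyD p q)) (lfpoly_wide A le_p) (lfpoly_wide A le_q).
by rewrite -big_split; apply: eq_bigr => i _; rewrite coefD scalerDl.
Qed.

Lemma lfpolyC A c : lfpoly A c%:P = c *: \1%VF.
Proof.
by rewrite (lfpoly_wide A (size_polyC_leq1 c)) big_ord1 coefC eqxx.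
Qed.

Lemma lfpoly0 A : lfpoly A 0 = 0.
Proof. by rewrite -polyC0 lfpolyC scale0r. Qed.

Lemma lfpoly1 A : lfpoly A 1 = \1%VF.
Proof. by rewrite -polyC1 lfpolyC scale1r. Qed.

Lemma lfpolyMX A p : lfpoly A (p * 'X) = (A \o lfpoly A p)%VF.
Proof.
have le_pX : (size (p * 'X)%R <= (size p).+1)%N.
  by rewrite (leq_trans (size_polyMleq _ _)) // size_polyX addn2.
rewrite (lfpoly_wide A le_pX) big_ord_recl coefMX eqxx scale0r add0r.
apply/lfunP => x; rewrite comp_lfunE !sum_lfunE linear_sum; apply: eq_bigr => i _.
by rewrite coefMX /= !scale_lfunE linearZ /= comp_lfunE.
Qed.

Lemma lfpolyX A : lfpoly A 'X = A.
Proof. by rewrite -['X]mul1r lfpolyMX lfpoly1 comp_lfun1r. Qed.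

Lemma lfpolyM A p q : lfpoly A (p * q) = (lfpoly A p \o lfpoly A q)%VF.
Proof.
elim/poly_ind: p => [|p c IHp]; first by rewrite mul0r lfpoly0 comp_lfun0l.
rewrite mulrDl lfpolyD mulrAC lfpolyMX IHp lfpolyD lfpolyMX comp_lfunDl comp_lfunA.
congr (_ + _); rewrite mul_polyC lfpolyC.
apply/lfunP => x; rewrite comp_lfunE !scale_lfunE id_lfunE.
rewrite (lfpoly_wide A (size_scale_leq c q)) /lfpoly !sum_lfunE scaler_sumr.
by apply: eq_bigr => i _; rewrite coefZ !scale_lfunE scalerA.
Qed.

Lemma lfpolyXsubC A c x : lfpoly A ('X - c%:P) x = A x - c *: x.
Proof. by rewrite -polyCN lfpolyD lfpolyX lfpolyC add_lfunE scale_lfunE id_lfunE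
  scaleNr. Qed.

Lemma lfpoly_comp_eq A p q x : lfpoly A p (lfpoly A q x) = lfpoly A q (lfpoly A p x).
Proof. by rewrite -!comp_lfunE -!lfpolyM mulrC. Qed.

Lemma lfpoly_dvd A p q : p %| q -> lfpoly A p = 0 -> lfpoly A q = 0.
Proof. by move=> /dvdpP[r ->] p0; rewrite lfpolyM p0 comp_lfun0r. Qed.

Lemma memv_lfpoly (V : {vspace 'End(X)}) A p :
  (forall k, lfpow A k \in V) -> lfpoly A p \in V.
Proof. by move=> AV; apply: memv_suml => i _; apply: memvZ. Qed.

(** There is one more power of [A] in [e] than the dimension of ['End(X)], so the powers are
    dependent, and the coefficients of a dependence form [p]. *)
Lemma lfpoly_annihilator A : exists2 p, p != 0 & lfpoly A p = 0.
Proof.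
pose n := (\dim {:'End(X)}).+1; pose e := [tuple lfpow A i | i < n].
have : ~~ free e.
  by apply/negP => /eqP; rewrite size_tuple => de; have := dimvS (subvf <<e>>);
    rewrite de ltnn.
apply: contraNP => noP; apply/freeP => k k0 i; apply/eqP/negPn/negP => ki_neq0.
case: noP; exists (\poly_(i < n) k (inord i)).
  apply: contraNneq ki_neq0 => /(congr1 (fun p : {poly R} => p`_i)).
  by rewrite coef_poly ltn_ord inord_val coef0 => ->.
rewrite (lfpoly_wide A (size_poly _ _)); apply: etrans k0; apply: eq_bigr => j _.
by rewrite coef_poly ltn_ord inord_val -tnth_nth tnth_mktuple.
Qed.

(** Newton's scheme: [w] vanishes at the earlier nodes, so a multiple of it corrects the value at
    [c] alone. *)
Lemma interpolation (f : R -> R) (s : seq R) : uniq s ->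
  exists p : {poly R}, {in s, forall c, p.[c] = f c}.
Proof.
elim: s => [|c s IHs] /=; first by exists 0.
case/andP=> cs /IHs[p ps]; pose w := \prod_(d <- s) ('X - d%:P).
have wc : w.[c] != 0 by rewrite -/(root _ _) root_prod_XsubC.
exists (p + ((f c - p.[c]) / w.[c])%:P * w) => d; rewrite inE => /orP[/eqP-> | ds].
  by rewrite hornerD hornerCM divfK // addrC subrK.
have /rootP wd : root w d by rewrite root_prod_XsubC.
by rewrite hornerD hornerCM wd mulr0 addr0 ps.
Qed.

(** The difference [p - q] vanishes at distinct nodes, hence is divisible by the annihilating
    product. *)
Lemma lfpoly_eq_on_roots A (s : seq R) p q :
  uniq s -> lfpoly A (\prod_(c <- s) ('X - c%:P)) = 0 ->
  {in s, forall c, p.[c] = q.[c]} -> lfpoly A p = lfpoly A q.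
Proof.
move=> us A0 pq; rewrite -[p](subrK q) lfpolyD (lfpoly_dvd _ A0) ?add0r //.
apply: uniq_roots_dvdp; last by rewrite uniq_rootsE.
by apply/allP => c /pq pqc; rewrite rootE !hornerE pqc subrr.
Qed.

End LfunPoly.

(** A root [a + i b] exists over [R[i]], which is algebraically closed. If [b] is nonzero, the
    remainder modulo [(X - a)^2 + b^2] is affine and vanishes at [a + i b]; its imaginary part, then
    its real part, force both coefficients to be zero. *)
Lemma rcf_poly_factor (R : rcfType) (p : {poly R}) : (1 < size p)%N ->
  (exists a q, p = q * ('X - a%:P)) \/
  (exists a b q, b != 0 /\ p = q * (('X - a%:P) ^+ 2 + (b ^+ 2)%:P)).
Proof.
move=> p_gt1; pose toC := real_complex R.
have /closed_rootP[[a b] /rootP pz] : size (map_poly toC p) != 1%N.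
  by rewrite size_map_poly neq_ltn p_gt1 orbT.
have [b0 | b_neq0] := eqVneq b 0.
  left; exists a; apply/factor_theorem; rewrite /root -(fmorph_eq0 toC).
  by rewrite -horner_map /= -[(a%:C)%C]/(Complex a 0) -b0 pz.
right; exists a, b; pose d := ('X - a%:P) ^+ 2 + (b ^+ 2)%:P.
have size_sq : size (('X - a%:P) ^+ 2 : {poly R}) = 3 by rewrite size_exp_XsubC.
have size_d : size d = 3.
  by rewrite size_polyDl size_sq // (leq_ltn_trans (size_polyC_leq1 _)).
have d_neq0 : d != 0 by rewrite -size_poly_gt0 size_d.
have d_monic : d \is monic.
  rewrite monicE lead_coefDl ?lead_coef_exp ?lead_coefXsubC ?expr1n //.
  by rewrite size_sq (leq_ltn_trans (size_polyC_leq1 _)).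
exists (p %/ d); split=> //; rewrite {1}(divp_eq p d) addrC.
suff -> : p %% d = 0 by rewrite add0r.
have := ltn_modp p d; rewrite d_neq0 size_d.
have := divp_eq p d; move: (p %/ d) (p %% d) => q r p_eq r_le2.
have rE : r = (r`_0)%:P + (r`_1)%:P * 'X.
  apply/polyP => -[|[|k]]; rewrite coefD coefC coefMX coefC /= ?addr0 ?add0r //.
  by rewrite nth_default // -ltnS (leq_trans r_le2).
have dz : (map_poly toC d).[Complex a b] = 0.
  rewrite rmorphD rmorphXn rmorphB /= map_polyX !map_polyC /= hornerD horner_exp.
  rewrite !hornerE; apply/eqP; rewrite eq_complex /=.
  by rewrite !(mul0r, mulr0, subrr, addr0, add0r, oppr0, subr0, expr2) addNr !eqxx.
have : (map_poly toC r).[Complex a b] = 0.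
  by move: pz; rewrite p_eq rmorphD rmorphM hornerD hornerM dz mulr0 add0r.
rewrite {1}rE rmorphD rmorphM /= map_polyX !map_polyC /= !hornerE.
move/eqP; rewrite eq_complex /= !(mul0r, mulr0, subr0, addr0, add0r).
rewrite mulf_eq0 (negPf b_neq0) orbF => /andP[/eqP + /eqP r1].
by rewrite r1 !mul0r addr0 => r0; rewrite rE r0 r1 polyC0 mul0r addr0.
Qed.

(** * Spectra of self-adjoint operators *)

Section SelfAdjoint.
Context {R : realType} {X : vectType R} (dot : {dot X for @idfun R}).
Implicit Types (A B P Q F : 'End(X)) (x y z v w : X).
Local Notation "'[ x , y ]" := (dot x y) : ring_scope.
Local Notation sa := (self_adjoint dot).

Lemma dotC x y : '[x, y] = '[y, x].
Proof. by rewrite (@hermC _ _ idfun) expr0 mul1r. Qed.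

Lemma dotDl x y z : '[x + y, z] = '[x, z] + '[y, z].
Proof. exact: linearDl. Qed.

Lemma dotDr x y z : '[x, y + z] = '[x, y] + '[x, z].
Proof. exact: linearDr. Qed.

Lemma dotNl x y : '[- x, y] = - '[x, y].
Proof. exact: linearNl. Qed.

Lemma dotNr x y : '[x, - y] = - '[x, y].
Proof. exact: linearNr. Qed.

Lemma dotZl a x y : '[a *: x, y] = a * '[x, y].
Proof. exact: linearZl_LR. Qed.

Lemma dotZr a x y : '[x, a *: y] = a * '[x, y].
Proof. by rewrite dotC dotZl dotC. Qed.

Lemma dot0l x : '[0, x] = 0. Proof. exact: linear0l. Qed.

Lemma dot0r x : '[x, 0] = 0. Proof. exact: linear0r. Qed.

Definition dotE := (dotDl, dotDr, dotNl, dotNr, dotZl, dotZr, dot0l, dot0r).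

Lemma dot_gt0 x : x != 0 -> 0 < '[x, x].
Proof. exact: neq0_dnorm_gt0. Qed.

Lemma dot_ge0 x : 0 <= '[x, x].
Proof. by have [->|/dot_gt0/ltW//] := eqVneq x 0; rewrite dot0l. Qed.

Lemma dot_eq0 x : '[x, x] = 0 -> x = 0.
Proof. by move=> x0; apply/eqP/negPn/negP => /dot_gt0; rewrite x0 ltxx. Qed.

Lemma self_adjointD A B : sa A -> sa B -> sa (A + B).
Proof. by move=> sA sB x y; rewrite !add_lfunE !dotE sA sB. Qed.

Lemma self_adjointZ a A : sa A -> sa (a *: A).
Proof. by move=> sA x y; rewrite !scale_lfunE !dotE sA. Qed.

Lemma self_adjointN A : sa A -> sa (- A).
Proof. by move=> sA x y; rewrite !opp_lfunE !dotE sA. Qed.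

Lemma self_adjointB A B : sa A -> sa B -> sa (A - B).
Proof. by move=> sA sB; apply/self_adjointD/self_adjointN. Qed.

Lemma self_adjoint1 : sa \1%VF.
Proof. by move=> x y; rewrite !id_lfunE. Qed.

Lemma self_adjoint0 : sa 0.
Proof. by move=> x y; rewrite !zero_lfunE !dotE. Qed.

Lemma self_adjoint_sandwich A B : sa A -> sa B -> sa (A \o B \o A)%VF.
Proof. by move=> sA sB x y; rewrite !comp_lfunE sA sB sA. Qed.

Lemma self_adjoint_lfpoly A p : sa A -> sa (lfpoly A p).
Proof.
move=> sA; elim/poly_ind: p => [|p c IHp]; first by rewrite lfpoly0;
  apply: self_adjoint0.
rewrite lfpolyD lfpolyC; apply: self_adjointD; last exact/self_adjointZ/self_adjoint1.
move=> x y; rewrite lfpolyMX !comp_lfunE sA IHp; congr (dot _ _).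
by rewrite -!comp_lfunE -lfpolyMX lfpolyM lfpolyX.
Qed.

Lemma self_adjoint_sqr_eq0 A x : sa A -> A (A x) = 0 -> A x = 0.
Proof. by move=> sA AAx; apply: dot_eq0; rewrite sA AAx dot0r. Qed.

Definition eigen A c := exists2 v, v != 0 & A v = c *: v.

(* The factor (A - c) is dropped from the annihilating product when c is not an
   eigenvalue or occurs already, the latter because self-adjoint operators have
   no nilpotent part; irreducible quadratic factors are injective. *)
Lemma self_adjoint_kernel A p : sa A -> p != 0 ->
  exists s : seq R, [/\ uniq s, forall c, c \in s -> eigen A c &
    forall x, lfpoly A p x = 0 -> lfpoly A (\prod_(c <- s) ('X - c%:P)) x = 0].
Proof.
move=> sA; have [n le_n] := ubnP (size p); elim: n => [|n IHn] in p le_n *;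
  first by [].
move=> p_neq0; have [p_le1 | p_gt1] := leqP (size p) 1.
  exists [::]; split=> // x; rewrite big_nil lfpoly1 id_lfunE.
  rewrite (size1_polyC p_le1) lfpolyC scale_lfunE id_lfunE => /eqP.
  rewrite scaler_eq0 => /orP[/eqP p0 | /eqP//].
  by move: p_neq0; rewrite (size1_polyC p_le1) p0 eqxx.
have [[a [q pE]] | [a [b [q [b_neq0 pE]]]]] := rcf_poly_factor p_gt1.
  have q_neq0 : q != 0 by apply: contraNneq p_neq0 => q0; rewrite pE q0 mul0r.
  have [|s [us es ks]] := IHn q _ q_neq0.
    by move: le_n; rewrite pE size_Mmonic ?monicXsubC // size_XsubC addn2.
  have ks' x : lfpoly A p x = 0 ->
      lfpoly A ('X - a%:P) (lfpoly A (\prod_(c <- s) ('X - c%:P)) x) = 0.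
    by rewrite pE lfpolyM comp_lfunE => /ks; rewrite lfpoly_comp_eq.
  have [as_ | a_s] := boolP (a \in s).
    exists s; split=> // x /ks'; rewrite (big_rem a) //= lfpolyM comp_lfunE.
    exact/self_adjoint_sqr_eq0/self_adjoint_lfpoly.
  have [ea | nea] := pselect (eigen A a).
    exists (a :: s); split=> [|c|x /ks']; first by rewrite /= a_s.
      by rewrite inE => /orP[/eqP-> // | /es].
    by rewrite big_cons lfpolyM comp_lfunE.
  exists s; split=> // x /ks'; rewrite lfpolyXsubC => /eqP;
    rewrite subr_eq0 => /eqP eq_a.
  apply/eqP/negPn/negP => neq0; case: nea;
    exists (lfpoly A (\prod_(c <- s) ('X - c%:P)) x) => //.
have q_neq0 : q != 0 by apply: contraNneq p_neq0 => q0; rewrite pE q0 mul0r.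
set d := ('X - a%:P) ^+ 2 + _ in pE.
(* Pairing [lfpoly A d y] with [y] gives [|(A - a) y|^2 + b^2 |y|^2]. *)
have d_inj y : lfpoly A d y = 0 -> y = 0.
  have sL := self_adjoint_lfpoly ('X - a%:P) sA.
  rewrite lfpolyD add_lfunE expr2 lfpolyM comp_lfunE lfpolyC scale_lfunE id_lfunE.
  move/(congr1 (dot y)); rewrite dotDr dotZr dot0r -sL => /eqP.
  rewrite (paddr_eq0 (dot_ge0 _) (mulr_ge0 (sqr_ge0 b) (dot_ge0 y))) => /andP[_].
  by rewrite mulf_eq0 sqrf_eq0 (negPf b_neq0) => /eqP/dot_eq0.
have size_d : size d = 3.
  by rewrite size_polyDl size_exp_XsubC // (leq_ltn_trans (size_polyC_leq1 _)).
have [|s [us es ks]] := IHn q _ q_neq0.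
  move: le_n; rewrite pE size_mul -?size_poly_gt0 ?size_d ?size_poly_gt0 //.
  by rewrite addn3 /= ltnS => /ltnW.
exists s; split=> // x; rewrite pE mulrC lfpolyM comp_lfunE => /d_inj; exact: ks.
Qed.

(** Serves in place of diagonalization: with [lfpoly_eq_on_roots], an identity between polynomials
    in [A] need only be checked at eigenvalues. *)
Lemma self_adjoint_spectrum A : sa A ->
  exists s : seq R, [/\ uniq s, forall c, c \in s -> eigen A c &
    lfpoly A (\prod_(c <- s) ('X - c%:P)) = 0].
Proof.
move=> sA; have [p p_neq0 pA] := lfpoly_annihilator A.
have [s [us es ks]] := self_adjoint_kernel sA p_neq0.
exists s; split=> //; apply/lfunP => x; rewrite zero_lfunE; apply: ks.
by rewrite pA zero_lfunE.
Qed.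

End SelfAdjoint.

(** * Square roots and inverses of positive operators *)

Section PosDef.
Context {R : realType} {X : vectType R} (dot : {dot X for @idfun R}).
Implicit Types (A B P Q F : 'End(X)) (x y z v w : X).
Local Notation sa := (self_adjoint dot).
Local Notation psd := (pos_semidef dot).
Local Notation pd := (pos_def dot).

Lemma pos_def_semidef A : pd A -> psd A.
Proof.
case=> sA pA; split=> // x; have [->|/pA/ltW//] := eqVneq x 0.
by rewrite dot0r.
Qed.

Lemma pos_semidefD A B : psd A -> psd B -> psd (A + B).
Proof.
case=> sA pA [sB pB]; split=> [|x]; first exact: self_adjointD.
by rewrite add_lfunE dotDl addr_ge0.
Qed.

Lemma pos_defD A B : pd A -> psd B -> pd (A + B).
Proof.
case=> sA pA [sB pB]; split=> [|x /pA Ax]; first exact: self_adjointD.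
by rewrite add_lfunE dotDl ltr_wpDr.
Qed.

Lemma pos_def_scalar a : 0 < a -> pd (a *: \1%VF).
Proof.
move=> a0; split=> [|x x0]; first exact/self_adjointZ/self_adjoint1.
by rewrite scale_lfunE id_lfunE dotZl mulr_gt0 // dot_gt0.
Qed.

Lemma pos_semidef0 : psd 0.
Proof. by split=> [|x]; [exact: self_adjoint0 | rewrite zero_lfunE dot0l]. Qed.

Lemma pos_semidef_sandwich A B : sa A -> psd B -> psd (A \o B \o A)%VF.
Proof.
move=> sA [sB pB]; split=> [|x]; first exact: self_adjoint_sandwich.
by rewrite !comp_lfunE sA.
Qed.

Lemma pos_semidef_sqr A : sa A -> psd (A \o A)%VF.
Proof.
by move=> sA; split=> [x y|x]; rewrite !comp_lfunE;
  [rewrite !sA | rewrite sA dot_ge0].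
Qed.

Lemma pos_semidef_eigen A c : psd A -> eigen A c -> 0 <= c.
Proof.
move=> [_ pA] [v /(dot_gt0 dot) v0 Av]; have := pA v.
by rewrite Av dotZl pmulr_lge0.
Qed.

Lemma pos_def_eigen A c : pd A -> eigen A c -> 0 < c.
Proof.
move=> [_ pA] [v v0 Av]; have := pA v v0.
by rewrite Av dotZl pmulr_lgt0 // dot_gt0.
Qed.

(** Interpolating the square root on the spectrum gives [p]. Interpolating the fourth root gives [q]
    with [lfpoly A p] equal to the square of [lfpoly A q], which makes it positive semidefinite. *)
Lemma eigen_ge0_sqrt A : sa A -> (forall c, eigen A c -> 0 <= c) ->
  exists p, psd (lfpoly A p) /\ (lfpoly A p \o lfpoly A p)%VF = A.
Proof.
move=> sA eA; have [s [us es s0]] := self_adjoint_spectrum sA.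
have [p pP] := interpolation Num.sqrt us.
have [q qP] := interpolation (fun c => Num.sqrt (Num.sqrt c)) us.
exists p; split; last first.
  rewrite -lfpolyM -[RHS]lfpolyX; apply: (lfpoly_eq_on_roots us s0) => c cs.
  by rewrite hornerM hornerX pP // -expr2 sqr_sqrtr //; apply/eA/es.
have <- : lfpoly A (q * q) = lfpoly A p.
  apply: (lfpoly_eq_on_roots us s0) => c cs.
  by rewrite hornerM pP ?qP // -expr2 sqr_sqrtr ?sqrtr_ge0.
by rewrite lfpolyM; apply/pos_semidef_sqr/self_adjoint_lfpoly.
Qed.

Lemma eigen_ge0_pos_semidef A : sa A -> (forall c, eigen A c -> 0 <= c) -> psd A.
Proof.
move=> sA /(eigen_ge0_sqrt sA)[p [[sB _] <-]]; exact: pos_semidef_sqr.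
Qed.

Lemma pos_semidef_sqrt A : psd A ->
  exists p, psd (lfpoly A p) /\ (lfpoly A p \o lfpoly A p)%VF = A.
Proof.
by move=> pA; apply: eigen_ge0_sqrt (proj1 pA) _ => c; apply: pos_semidef_eigen.
Qed.

(** If [<B x, x> = 0], then a square root [C] of [B] kills [x], hence so do [B] and [A]. *)
Lemma pos_def_sqrt A B : pd A -> psd B -> (B \o B)%VF = A -> pd B.
Proof.
move=> [sA pA] pB BB; split=> [|x x0]; first by case: pB.
have [p [[sC _] CC]] := pos_semidef_sqrt pB.
rewrite lt_neqAle (proj2 pB) andbT eq_sym; apply: contraTneq x0 => Bx.
have Cx : lfpoly B p x = 0 by apply: (dot_eq0 (dot := dot));
  rewrite -sC -comp_lfunE CC.
have B0 : B x = 0 by rewrite -CC comp_lfunE Cx linear0.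
apply/negP => /pA; by rewrite -BB comp_lfunE B0 linear0 dot0l ltxx.
Qed.

Lemma pos_def_lker0 A : pd A -> lker A == 0%VS.
Proof.
move=> [_ pA]; apply/lker0P => x y xy; apply/eqP; rewrite -subr_eq0.
by apply/negPn/negP => /pA; rewrite (linearB A) /= xy subrr dot0l ltxx.
Qed.

Lemma pos_defVf A : pd A -> (A^-1 \o A)%VF = \1%VF.
Proof. by move/pos_def_lker0/lker0_compVf. Qed.

Lemma pos_deffV A : pd A -> (A \o A^-1)%VF = \1%VF.
Proof. by move/pos_def_lker0/lker0_compfV. Qed.

Lemma pos_def_inv_unique A B : pd A -> (A \o B)%VF = \1%VF -> (A^-1)%VF = B.
Proof.
by move=> pA AB; rewrite -[LHS]comp_lfun1r -AB comp_lfunA pos_defVf // comp_lfun1l.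
Qed.

Lemma pos_defVK A x : pd A -> A ((A^-1)%VF x) = x.
Proof. by move=> pA; rewrite -comp_lfunE pos_deffV // id_lfunE. Qed.

Lemma pos_def_inv A : pd A -> pd (A^-1)%VF.
Proof.
move=> pA; split=> [x y|x x0].
  by rewrite -{1}[y](pos_defVK _ pA) -(proj1 pA) pos_defVK.
rewrite -{2}[x](pos_defVK _ pA) dotC.
by apply: (proj2 pA); apply: contraNneq x0 => Vx0;
  rewrite -[x](pos_defVK _ pA) Vx0 linear0.
Qed.

Lemma pos_def_inv_lfpoly A : pd A -> exists p, (A^-1)%VF = lfpoly A p.
Proof.
move=> pA; have [s [us es s0]] := self_adjoint_spectrum (proj1 pA).
have [p pP] := interpolation GRing.inv us; exists p.
apply: pos_def_inv_unique => //.
rewrite -{1}[A](lfpolyX A) -lfpolyM -(lfpoly1 A).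
apply: (lfpoly_eq_on_roots us s0) => c cs; rewrite hornerM hornerX hornerC pP //.
by rewrite divff // gt_eqF // (pos_def_eigen pA (es c cs)).
Qed.

(** Existence of a root keeps [xget] away from its default value. *)
Lemma lfsqrtP A : psd A ->
  psd (lfsqrt dot A) /\ (lfsqrt dot A \o lfsqrt dot A)%VF = A.
Proof.
case/pos_semidef_sqrt => p pP.
pose D := [set B : 'End(X) | psd B /\ (B \o B)%VF = A]%classic.
by apply: (@xgetPex _ 0 D); exists (lfpoly A p).
Qed.

Lemma lfsqrt_pos_semidef A : psd A -> psd (lfsqrt dot A).
Proof. by case/lfsqrtP. Qed.

Lemma lfsqrtK A : psd A -> (lfsqrt dot A \o lfsqrt dot A)%VF = A.
Proof. by case/lfsqrtP. Qed.

Lemma lfsqrt_pos_def A : pd A -> pd (lfsqrt dot A).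
Proof.
move=> pA; have psA := pos_def_semidef pA.
exact: pos_def_sqrt pA (lfsqrt_pos_semidef psA) (lfsqrtK psA).
Qed.

(* An eigenvector [v] of [B - A] with eigenvalue [c] satisfies
   [c <v, (A + B) v> = |B v|^2 - |A v|^2]. *)
Lemma sqr_le_pos_def A B : pd A -> psd B ->
  psd ((B \o B) - (A \o A))%VF -> psd (B - A).
Proof.
move=> pA pB [_ pBA]; have [[sA qA] [sB qB]] := (pA, pB).
apply: eigen_ge0_pos_semidef => [|c [v v0]]; first exact: self_adjointB.
rewrite add_lfunE opp_lfunE => /eqP; rewrite subr_eq => /eqP Bv.
have := pBA v; rewrite add_lfunE opp_lfunE !comp_lfunE dotDl dotNl sA sB Bv !dotE.
have := qB v; rewrite Bv !dotE [dot v (A v)]dotC.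
have := qA v v0; set a := dot (A v) v; set n := dot v v => a0 na sq.
suff : 0 <= c * (c * n + a + a) by rewrite pmulr_lge0 // ltr_wpDl.
lra.
Qed.

(** Applying [sqr_le_pos_def] in both directions makes the quadratic form of [A - B] vanish. *)
Lemma pos_def_sqr_inj A B : pd A -> pd B -> (A \o A)%VF = (B \o B)%VF -> A = B.
Proof.
move=> pA pB AB.
have [_ h1] : psd (B - A).
  by apply: sqr_le_pos_def => //; rewrite ?AB ?subrr;
    [exact: pos_def_semidef | exact: pos_semidef0].
have [_ h2] : psd (A - B).
  by apply: sqr_le_pos_def => //; rewrite ?AB ?subrr;
    [exact: pos_def_semidef | exact: pos_semidef0].
have h0 x : dot ((A - B) x) x = 0.
  apply/eqP; rewrite eq_le h2 andbT.
  by have := h1 x; rewrite -opprB opp_lfunE dotNl oppr_ge0.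
have s0 : sa (A - B) by apply: self_adjointB; [case: pA | case: pB].
apply/eqP; rewrite -subr_eq0; apply/eqP/lfunP => x; rewrite zero_lfunE.
move: (A - B) h0 s0 => D h0 s0; apply: (dot_eq0 (dot := dot)).
(* When the form of [D] vanishes at [x] and [D x], its value at [x + D x] is [2 |D x|^2]. *)
have := h0 (x + D x); have := h0 x; have := h0 (D x).
by rewrite (linearD D) !dotE (s0 (D x) x) => -> ->; lra.
Qed.

(** Uniqueness identifies the root picked by [lfsqrt] with the polynomial one; this is what later
    places it in [H]. *)
Lemma lfsqrt_lfpoly A : pd A -> exists p, lfsqrt dot A = lfpoly A p.
Proof.
move=> pA; have psA := pos_def_semidef pA.
have [p [pB BB]] := pos_semidef_sqrt psA; exists p.
apply: pos_def_sqr_inj; first exact: lfsqrt_pos_def.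
  exact: pos_def_sqrt pA pB BB.
by rewrite BB lfsqrtK.
Qed.

(* With [y := B^-1 x] and [z := A^-1 x], expand [0 <= <A (y - z), y - z>]. *)
Lemma inv_antitone A B : pd A -> pd B -> psd (B - A) -> psd ((A^-1)%VF - (B^-1)%VF).
Proof.
move=> pA pB [_ qBA]; have [siA _] := pos_def_inv pA; have [siB _] := pos_def_inv pB.
split=> [|x]; first exact: self_adjointB.
rewrite add_lfunE opp_lfunE dotDl dotNl subr_ge0.
set z := (A^-1)%VF x; set y := (B^-1)%VF x.
have := qBA y; rewrite add_lfunE opp_lfunE dotDl dotNl subr_ge0.
rewrite {1}/y pos_defVK //.
have [_ qA] := pos_def_semidef pA; have := qA (y - z).
rewrite (linearB A) !dotE /= (proj1 pA y z) [A z]pos_defVK // ![dot x _]dotC.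
set a := dot (A y) y; set b := dot y x; set c := dot z x; lra.
Qed.

Lemma pos_semidef_AMGM A x y : psd A ->
  2 * dot (A x) y <= dot (A x) x + dot (A y) y.
Proof.
move=> [sA pA]; have := pA (x - y).
rewrite (linearB A) !dotE /= [dot (A y) x]sA [dot y _]dotC; lra.
Qed.

End PosDef.

(** * The trace *)

Section Trace.
Context {R : realType} {X : vectType R} (dot : {dot X for @idfun R}).
Implicit Types (A B P Q F : 'End(X)) (x y z v w : X).
Local Notation sa := (self_adjoint dot).
Local Notation psd := (pos_semidef dot).
Local Notation tr := lftrace.

Lemma outE z x : out dot z x = dot z x *: z.
Proof.
have lin_out : linear (fun x => dot z x *: z).
  by move=> a u v; rewrite !dotE scalerDl scalerA.
pose f : {linear X -> X} := HB.pack (fun x => dot z x *: z)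
  (GRing.isLinear.Build R X X _ (fun x => dot z x *: z) lin_out).
exact: (lfunE f).
Qed.

Lemma out_pos_semidef z : psd (out dot z).
Proof.
split=> [x y|x]; rewrite !outE !dotE; last by rewrite -expr2 sqr_ge0.
by rewrite [dot x z]dotC mulrC.
Qed.

Lemma lftraceD A B : tr (A + B) = tr A + tr B.
Proof. by rewrite /lftrace linearD mxtraceD. Qed.

Lemma lftraceZ a A : tr (a *: A) = a * tr A.
Proof. by rewrite /lftrace linearZ mxtraceZ. Qed.

Lemma lftraceN A : tr (- A) = - tr A.
Proof. by rewrite -scaleN1r lftraceZ mulN1r. Qed.

Lemma lftraceB A B : tr (A - B) = tr A - tr B.
Proof. by rewrite lftraceD lftraceN. Qed.

Lemma lftrace0 : tr (0 : 'End(X)) = 0.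
Proof. by rewrite -[0 in LHS](scale0r 0) lftraceZ mul0r. Qed.

Lemma lftraceC A B : tr (A \o B)%VF = tr (B \o A)%VF.
Proof.
by rewrite /lftrace !(mxof_comp _ _ (vbasisP _)) mxtrace_mulC.
Qed.

(** In the basis [e], the i-th diagonal entry is [<z, e_i>] times the i-th coordinate of [A z];
    these sum to [<z, A z>]. *)
Lemma lftrace_comp_out A z : tr (A \o out dot z)%VF = dot (A z) z.
Proof.
rewrite /lftrace /mxtrace; pose e := vbasis (@fullv R X).
have eP : basis_of fullv e by apply: vbasisP.
rewrite {1}(coord_basis eP (memvf (A z))) dotC linear_sumr.
apply: eq_bigr => i _; rewrite !mxE /= vecof_delta comp_lfunE outE.
by rewrite dotZr !linearZ /= mulrC.
Qed.

(* Gram-Schmidt, phrased as the construction of the projection [\sum_e out e]. *)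
Lemma out_sum_span (b : seq X) : exists s : seq X,
  let P := \sum_(e <- s) out dot e in
  (P \o P)%VF = P /\ forall v, v \in b -> P v = v.
Proof.
elim: b => [|v b [s [PP Pb]]].
  by exists [::]; rewrite /= big_nil comp_lfun0l.
set P := \sum_(e <- s) _ in PP Pb.
have sP : sa P.
  by rewrite /P; apply: big_ind => [|A B|e _];
    [exact: self_adjoint0 | exact: self_adjointD | case: (out_pos_semidef e)].
have PPx x : P (P x) = P x by rewrite -comp_lfunE PP.
have [w0|w_neq0] := eqVneq (v - P v) 0.
  exists s; split=> // u; rewrite inE => /orP[/eqP->|]; last exact: Pb.
  by apply/esym/eqP; rewrite -subr_eq0 w0.
set w := v - P v in w_neq0; have w_gt0 := dot_gt0 dot w_neq0.
have Pw : P w = 0 by rewrite linearB /= PPx subrr.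
pose e := (Num.sqrt (dot w w))^-1 *: w; exists (e :: s); rewrite big_cons -/P /=.
have eE x : out dot e x = (dot w x / dot w w) *: w.
  rewrite outE /e dotZl scalerA mulrAC -invfM -expr2 sqr_sqrtr ?ltW //.
  by rewrite mulrC.
have Pe : P e = 0 by rewrite linearZ /= Pw scaler0.
have wP x : dot w (P x) = 0 by rewrite -sP Pw dot0l.
split=> [|u].
  apply/lfunP => x; rewrite comp_lfunE !add_lfunE !eE [P (_ + _)]linearD /= [P (_ *:
    _)]linearZ /= Pw scaler0 add0r PPx.
  by rewrite dotDr dotZr wP addr0 divfK ?gt_eqF.
rewrite inE add_lfunE eE => /orP[/eqP->|/Pb Pu];
  last by rewrite -Pu wP mul0r scale0r add0r PPx.
have -> : dot w v = dot w w by rewrite -{1}(subrK (P v) v) dotDr wP addr0.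
by rewrite divff ?gt_eqF // scale1r subrK.
Qed.

Lemma resolution_of_identity : exists s : seq X, \1%VF = \sum_(e <- s) out dot e.
Proof.
have [s [_ sP]] := out_sum_span (vbasis (@fullv R X)); exists s.
apply/lfunP => x; rewrite id_lfunE [x](coord_vbasis (memvf x)) linear_sum /=.
apply: eq_bigr => i _; rewrite linearZ /= sP //.
by rewrite mem_nth // size_tuple.
Qed.

(** Resolving the identity into rank-one operators writes the trace as a sum of terms [<A e, e>]. *)
Lemma lftrace_ge0 A : psd A -> 0 <= tr A.
Proof.
move=> [_ pA]; have [s s1] := resolution_of_identity.
rewrite -[A]comp_lfun1r s1 -[(A \o _)%VF]/(comp_lfun A _).
have -> : (A \o \sum_(e <- s) out dot e = \sum_(e <- s) (A \o out dot e))%VF.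
  by apply: (big_morph (comp_lfun A)) => [B C|];
    [exact: comp_lfunDr | exact: comp_lfun0r].
elim/big_ind: _ => [|B C B0 C0|e _]; first by rewrite lftrace0.
  by rewrite lftraceD addr_ge0.
by rewrite lftrace_comp_out.
Qed.

(** For a square root [C] of [A], cyclicity turns the trace of [A B] into that of [C B C]. *)
Lemma lftrace_mul_ge0 A B : psd A -> psd B -> 0 <= tr (A \o B)%VF.
Proof.
move=> pA pB; have [p [[sC _] CC]] := pos_semidef_sqrt pA.
rewrite -CC -comp_lfunA lftraceC; apply: lftrace_ge0.
exact: pos_semidef_sandwich.
Qed.

Lemma lftrace_mul_le A B F : psd F -> psd (B - A) -> tr (F \o A)%VF <= tr (F \o B)%VF.
Proof.
move=> pF pBA; rewrite -subr_ge0 -lftraceB -comp_lfunNr -comp_lfunDr.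
exact: lftrace_mul_ge0.
Qed.

(** Cauchy-Schwarz as an operator inequality, from expanding the squared norm of
    [|z|^2 x - <z, x> z]. *)
Lemma norm_sqr_sub_out_pos_semidef z : psd (dot z z *: \1%VF - out dot z).
Proof.
split=> [|x].
  by apply: self_adjointB; [exact/self_adjointZ/self_adjoint1 | case:
    (out_pos_semidef z)].
rewrite add_lfunE opp_lfunE scale_lfunE id_lfunE outE !dotE subr_ge0.
have [->|z0] := eqVneq z 0; first by rewrite !dot0l !mul0r.
have z_gt0 := dot_gt0 dot z0; have := dot_ge0 dot (dot z z *: x - dot z x *: z).
rewrite !dotE [dot x z]dotC; set a := dot z z; set b := dot z x;
  set c := dot x x => h.
suff : 0 <= a * (a * c - b * b) by rewrite pmulr_rge0 // subr_ge0.
move: h; lra.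
Qed.

Lemma pos_semidef_le_lftrace A x : psd A -> dot (A x) x <= tr A * dot x x.
Proof.
move=> pA; rewrite -lftrace_comp_out mulrC -lftraceZ -[_ *: A]comp_lfun1r.
rewrite -comp_lfunZl comp_lfunZr; apply: lftrace_mul_le => //.
exact: norm_sqr_sub_out_pos_semidef.
Qed.

(** Since [|A x|^2 <= tr (A^2) |x|^2], the trace form is definite on self-adjoint operators;
    projections are unique for this reason. *)
Lemma lftrace_sqr_eq0 A : sa A -> tr (A \o A)%VF = 0 -> A = 0.
Proof.
move=> sA A0; apply/lfunP => x; rewrite zero_lfunE; apply: (dot_eq0 (dot := dot)).
apply/eqP; rewrite eq_le dot_ge0 andbT -sA -comp_lfunE.
by have := pos_semidef_le_lftrace x (pos_semidef_sqr sA); rewrite A0 mul0r.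
Qed.

Lemma adjoint_self_adjoint A : sa A -> adjoint dot A = A.
Proof.
move=> sA; have adjP x y : dot (A x) y = dot x (adjoint dot A y).
  pose D := [set B : 'End(X) | forall x y, dot (A x) y = dot x (B y)]%classic.
  by move: x y; apply: (@xgetPex _ 0 D); exists A.
apply/lfunP => y; apply/eqP; rewrite -subr_eq0; apply/eqP/(dot_eq0 (dot := dot)).
by rewrite dotDr dotNr -adjP sA subrr.
Qed.

(** Writing [B] for [lfsqrt dot A], the product of [B] with its adjoint is [B^2 = A], so the root
    taken inside [trace_norm] is [B] again. *)
Lemma trace_norm_pos_semidef A : psd A -> trace_norm dot (lfsqrt dot A) = tr (lfsqrt
  dot A).
Proof.
move=> pA; have [sB pB] := lfsqrt_pos_semidef pA.
by rewrite /trace_norm (adjoint_self_adjoint sB) lfsqrtK.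
Qed.

End Trace.

(** * Projection onto a space of self-adjoint operators *)

Section Projection.
Context {R : realType} {X : vectType R} (dot : {dot X for @idfun R}).
Implicit Types (A B P Q F : 'End(X)) (x y z v w : X).
Local Notation sa := (self_adjoint dot).
Local Notation psd := (pos_semidef dot).
Local Notation pd := (pos_def dot).
Local Notation tr := lftrace.

(** Gram-Schmidt on a spanning list: [E] is the part of the new element [G] orthogonal to the span
    of [b]. *)
Lemma lftrace_proj_exists (b : seq 'End(X)) A :
  (forall F, F \in <<b>>%VS -> sa F) ->
  exists2 P, P \in <<b>>%VS & forall F, F \in <<b>>%VS -> tr ((A - P) \o F)%VF = 0.
Proof.
elim: b A => [|G b IHb] A sb.
  exists 0; first exact: mem0v.
  by move=> F; rewrite span_nil memv0 => /eqP->; rewrite comp_lfun0r lftrace0.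
have sub_b F : F \in <<b>>%VS -> F \in <<G :: b>>%VS.
  by rewrite span_cons; apply/subvP/addvSr.
have Gb : G \in <<G :: b>>%VS by rewrite memv_span ?mem_head.
have sb' F : F \in <<b>>%VS -> sa F by move/sub_b/sb.
have [Q Qb Qorth] := IHb G sb'; have [P Pb Porth] := IHb A sb'.
pose E := G - Q; have Eb : E \in <<G :: b>>%VS by apply: memvB => //; apply: sub_b.
(* If the denominator is 0, then [E = 0] by [lftrace_sqr_eq0], and any value of [c] works. *)
pose c := tr ((A - P) \o E)%VF / tr (E \o E)%VF.
exists (P + c *: E) => [|F]; first by apply: memvD; [exact: sub_b | exact: memvZ].
have cE : tr ((A - (P + c *: E)) \o E)%VF = 0.
  rewrite opprD addrA comp_lfunDl lftraceD comp_lfunNl -comp_lfunZl lftraceN lftraceZ.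
  have [E0|E_neq0] := eqVneq (tr (E \o E)%VF) 0; last by rewrite /c divfK // subrr.
  by rewrite (lftrace_sqr_eq0 (sb _ Eb) E0) !comp_lfun0r lftrace0 mulr0 subr0.
have bE F' : F' \in <<b>>%VS -> tr ((A - (P + c *: E)) \o F')%VF = 0.
  move=> Fb; rewrite opprD addrA comp_lfunDl lftraceD Porth // add0r.
  by rewrite comp_lfunNl -comp_lfunZl lftraceN lftraceZ Qorth // mulr0 oppr0.
rewrite span_cons => /memv_addP[_ /vlineP[a ->] [F' Fb ->]].
have -> : a *: G + F' = a *: E + (a *: Q + F').
  by rewrite /E scalerBr addrA subrK.
rewrite comp_lfunDr lftraceD -comp_lfunZr lftraceZ cE mulr0 add0r bE //.
by rewrite memvD ?memvZ.
Qed.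

Variable H : {vspace 'End(X)}.
Hypothesis H_sa : forall A : 'End(X), A \in H -> sa A.
Hypothesis H_id : \1%VF \in H.

Lemma proj_orthogonal A : proj dot H A \in H /\ forall F, F \in H -> tr ((A - proj
  dot H A) \o F)%VF = 0.
Proof.
pose D := [set P : 'End(X) | P \in H /\ forall F, F \in H -> opdot dot (A - P) F =
  0]%classic.
have [PH Porth] : D (proj dot H A).
  apply: (@xgetPex _ 0 D); have := span_basis (vbasisP H).
  have := @lftrace_proj_exists (vbasis H) A; move=> + HE;
    rewrite HE => /(_ H_sa)[P PH Porth].
  by exists P; split=> // F FH; rewrite /opdot (adjoint_self_adjoint (H_sa FH)) Porth.
by split=> // F FH; rewrite -[in LHS](adjoint_self_adjoint (H_sa FH)) [LHS]Porth.
Qed.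

Lemma memv_proj A : proj dot H A \in H.
Proof. by case: (proj_orthogonal A). Qed.

Lemma lftrace_proj A F : F \in H -> tr (proj dot H A \o F)%VF = tr (A \o F)%VF.
Proof.
move=> FH; apply/eqP; rewrite eq_sym -subr_eq0 -lftraceB -comp_lfunNl -comp_lfunDl.
by have [_ ->] := proj_orthogonal A.
Qed.

Lemma proj_unique A P : P \in H ->
  (forall F, F \in H -> tr (P \o F)%VF = tr (A \o F)%VF) -> proj dot H A = P.
Proof.
move=> PH PA; apply/eqP; rewrite -subr_eq0; apply/eqP.
have DH : proj dot H A - P \in H by rewrite memvB ?memv_proj.
apply: (lftrace_sqr_eq0 (H_sa DH)).
by rewrite comp_lfunDl comp_lfunNl lftraceB lftrace_proj // PA // subrr.
Qed.

Lemma projD1 a A : proj dot H (A + a *: \1%VF) = proj dot H A + a *: \1%VF.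
Proof.
apply: proj_unique => [|F FH]; first by rewrite memvD ?memvZ ?memv_proj.
by rewrite !comp_lfunDl !lftraceD lftrace_proj.
Qed.

Hypothesis H_proj : forall A : 'End(X), pd A -> pd (proj dot H A).

(** A negative value of the form at [x] would contradict [H_proj] for [A + e \1], where [e > 0] is
    chosen so that the form of the projection becomes exactly 0 at [x]. *)
Lemma proj_pos_semidef A : psd A -> psd (proj dot H A).
Proof.
move=> pA; split=> [|x]; first exact/H_sa/memv_proj.
rewrite leNgt; apply/negP => lt0.
have x0 : x != 0 by apply: contraTneq lt0 => ->; rewrite dot0r ltxx.
have x_gt0 := dot_gt0 dot x0; set a := dot (proj dot H A x) x in lt0.
pose e := - a / dot x x; have e_gt0 : 0 < e by rewrite divr_gt0 ?oppr_gt0.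
have [_ /(_ x x0)] : pd (proj dot H (A + e *: \1%VF)).
  by apply: H_proj; rewrite addrC; apply: pos_defD => //; apply: pos_def_scalar.
rewrite projD1 add_lfunE scale_lfunE id_lfunE dotDl dotZl /e divfK ?gt_eqF //.
by rewrite subrr ltxx.
Qed.

Local Notation phi x := (proj dot H (out dot x)).

Lemma lftrace_phi F x : F \in H -> tr (F \o phi x)%VF = dot (F x) x.
Proof. by move=> FH; rewrite lftraceC lftrace_proj // lftraceC lftrace_comp_out. Qed.

Lemma phi_pos_semidef x : psd (phi x).
Proof. exact/proj_pos_semidef/out_pos_semidef. Qed.

Lemma phi0 : phi 0 = 0.
Proof.
apply: proj_unique => [|F FH]; first exact: mem0v.
by rewrite comp_lfun0l lftrace0 lftraceC lftrace_comp_out dot0r.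
Qed.

(** Pythagoras: expand [tr ((A - P)^2) >= 0] and use [tr (P A) = tr (P P)]. *)
Lemma lftrace_sqr_proj_le A : sa A ->
  tr (proj dot H A \o proj dot H A)%VF <= tr (A \o A)%VF.
Proof.
move=> sA; set P := proj dot H A; have PH : P \in H := memv_proj A.
have := lftrace_ge0 (pos_semidef_sqr (self_adjointB sA (H_sa PH))).
rewrite !(comp_lfunDl, comp_lfunDr, comp_lfunNl, comp_lfunNr) !(lftraceD, lftraceN).
rewrite [tr (A \o P)%VF]lftraceC.
have -> : tr (P \o A)%VF = tr (P \o P)%VF by rewrite lftraceC -lftrace_proj.
lra.
Qed.

(** A local Lipschitz bound for [phi], which controls the second-order remainder in
    [sqrt_phiD_gradient]. *)
Lemma lftrace_sqr_phiB x h : dot h h <= 1 ->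
  tr ((phi (x + h) - phi x) \o (phi (x + h) - phi x))%VF <= (6 * dot x x + 3) * dot h
    h.
Proof.
move=> h_le1; set Z := out dot (x + h) - out dot x.
have -> : phi (x + h) - phi x = proj dot H Z.
  apply/esym/proj_unique => [|F FH]; first by rewrite memvB ?memv_proj.
  by rewrite /Z !comp_lfunDl !comp_lfunNl !lftraceB !lftrace_proj.
have sZ : sa Z by apply: self_adjointB; case: (out_pos_semidef dot (x + h))
  (out_pos_semidef dot x) => + _ [].
apply: le_trans (lftrace_sqr_proj_le sZ) _.
rewrite /Z comp_lfunDr comp_lfunNr lftraceB !lftrace_comp_out.
rewrite !add_lfunE !opp_lfunE !outE !dotE [dot h x]dotC.
have := norm_sqr_sub_out_pos_semidef dot x => -[_ /(_ h)].
rewrite add_lfunE opp_lfunE scale_lfunE id_lfunE outE !dotE.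
move: (dot_ge0 dot h) h_le1; set s := dot x x; set c := dot x h; set q := dot h h.
have s0 : 0 <= s := dot_ge0 dot x.
(* The trace equals [2 c^2 + q^2 + 2 s q + 4 c q]. The bounds [4 c q <= 2 c^2 + 2 q^2], [c^2 <= s q]
   and [q^2 <= q] give [(6 s + 3) q]. *)
move=> q0 q1 cs; have := sqr_ge0 (c - q); have : 0 <= q * (1 - q) by rewrite mulr_ge0
  // subr_ge0.
lra.
Qed.

End Projection.

(** * The trace of the square root *)

Section TraceSqrt.
Context {R : realType} {X : vectType R} (dot : {dot X for @idfun R}).
Implicit Types (A B P Q F D : 'End(X)) (x y z v w : X).
Local Notation sa := (self_adjoint dot).
Local Notation psd := (pos_semidef dot).
Local Notation pd := (pos_def dot).
Local Notation tr := lftrace.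
Local Notation sqrt A := (lfsqrt dot A).

Lemma lftrace_sqrt_inv_mul A : pd A -> tr ((sqrt A)^-1 \o A)%VF = tr (sqrt A).
Proof.
move=> pA; have pB := lfsqrt_pos_def pA.
by rewrite -{2}(lfsqrtK (pos_def_semidef pA)) comp_lfunA (pos_defVf pB) comp_lfun1l.
Qed.

(** An exact expansion, from multiplying out the last trace. Dropping that term gives concavity;
    bounding it gives differentiability. *)
Lemma lftrace_sqrtE A A' : pd A -> psd A' ->
  tr (sqrt A') = tr (sqrt A) + 2^-1 * tr ((sqrt A)^-1 \o (A' - A))%VF
    - 2^-1 * tr ((sqrt A)^-1 \o ((sqrt A' - sqrt A) \o (sqrt A' - sqrt A)))%VF.
Proof.
move=> pA pA'; have pB := lfsqrt_pos_def pA.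
rewrite !(comp_lfunDl, comp_lfunDr, comp_lfunNl, comp_lfunNr) !(lftraceD, lftraceN).
rewrite !lfsqrtK //; last exact: pos_def_semidef.
rewrite lftrace_sqrt_inv_mul //.
rewrite ![tr ((sqrt A)^-1 \o (_ \o _))%VF]lftraceC -!comp_lfunA (pos_deffV pB).
rewrite [tr (sqrt A \o _)%VF]lftraceC -comp_lfunA (pos_defVf pB) !comp_lfun1r; lra.
Qed.

Lemma lftrace_sqrt_concave A A' : pd A -> psd A' ->
  tr (sqrt A') <= tr (sqrt A) + 2^-1 * tr ((sqrt A)^-1 \o (A' - A))%VF.
Proof.
move=> pA pA'; have pB := lfsqrt_pos_def pA; rewrite [leLHS](lftrace_sqrtE pA pA').
rewrite gerBl mulr_ge0 ?invr_ge0 ?ler0n //.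
apply: (lftrace_mul_ge0 (dot := dot)).
  exact/pos_def_semidef/pos_def_inv.
apply/pos_semidef_sqr/self_adjointB; last by case: pB.
by case: (lfsqrt_pos_semidef pA').
Qed.

Lemma lfsqrt_monotone A A' : pd A -> psd (A' - A) -> psd (sqrt A' - sqrt A).
Proof.
move=> pA pD; have pA' : pd A' by rewrite -(subrK A A') addrC; apply: pos_defD.
apply: sqr_le_pos_def; first exact: lfsqrt_pos_def.
  exact/pos_def_semidef/lfsqrt_pos_def.
by rewrite !lfsqrtK //; apply: pos_def_semidef.
Qed.

Lemma lfsqrt_inv_antitone A A' : pd A -> psd (A' - A) ->
  psd ((sqrt A)^-1%VF - (sqrt A')^-1%VF).
Proof.
move=> pA pD; have pA' : pd A' by rewrite -(subrK A A') addrC; apply: pos_defD.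
by apply: inv_antitone; [exact: lfsqrt_pos_def | exact: lfsqrt_pos_def | exact:
  lfsqrt_monotone].
Qed.

(** For the roots [B], [B'] of [A], [A'] one has [tr (B'^-1 A') = tr B'], while antitonicity of the
    inverse root gives [tr (B'^-1 A) <= tr (B^-1 A) = tr B]. *)
Lemma lftrace_sqrtB_le A A' : pd A -> psd (A' - A) ->
  tr (sqrt A') - tr (sqrt A) <= tr ((sqrt A')^-1 \o (A' - A))%VF.
Proof.
move=> pA pD; have pA' : pd A' by rewrite -(subrK A A') addrC; apply: pos_defD.
rewrite comp_lfunDr comp_lfunNr lftraceB lftrace_sqrt_inv_mul // lerD2l lerN2.
rewrite -[leRHS]lftrace_sqrt_inv_mul // ![tr (_ \o A)%VF]lftraceC.
by apply: (lftrace_mul_le (dot := dot)); [exact: pos_def_semidef | exact: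
  lfsqrt_inv_antitone].
Qed.

Variable delta : R.
Hypothesis delta_gt0 : 0 < delta.

Lemma lfsqrt_ge_scalar A : pd A -> psd (A - (delta ^+ 2) *: \1%VF) ->
  psd (sqrt A - delta *: \1%VF).
Proof.
move=> pA pAd; apply: sqr_le_pos_def; first exact: pos_def_scalar.
  exact/pos_def_semidef/lfsqrt_pos_def.
rewrite lfsqrtK; last exact: pos_def_semidef.
by rewrite -comp_lfunZl -comp_lfunZr comp_lfun1l scalerA -expr2.
Qed.

Lemma lfsqrt_inv_le_scalar A : pd A -> psd (A - (delta ^+ 2) *: \1%VF) ->
  psd (delta^-1 *: \1%VF - (sqrt A)^-1%VF).
Proof.
move=> pA pAd; have pd1 : pd (delta *: \1%VF) by apply: pos_def_scalar.
have <- : (delta *: \1)^-1%VF = delta^-1 *: \1%VF :> 'End(X).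
  apply: (pos_def_inv_unique pd1).
  by rewrite -comp_lfunZl comp_lfun1l scalerA divff ?scale1r // gt_eqF.
by apply: inv_antitone => //; [exact: lfsqrt_pos_def | exact: lfsqrt_ge_scalar].
Qed.

(** The square root is Lipschitz with constant [1 / (2 delta)] in the trace form. From
    [D = Y E + E B] and [Y, B >= delta] follows [tr (E D) >= 2 delta tr (E^2)]; then expand
    [tr ((2 delta E - D)^2) >= 0]. *)
Lemma lftrace_sqr_sqrtB_le A A' : pd A -> pd A' ->
  psd (A - (delta ^+ 2) *: \1%VF) -> psd (A' - (delta ^+ 2) *: \1%VF) ->
  4 * delta ^+ 2 * tr ((sqrt A' - sqrt A) \o (sqrt A' - sqrt A))%VF
    <= tr ((A' - A) \o (A' - A))%VF.
Proof.
move=> pA pA' pAd pA'd; have [sB _] := lfsqrt_pos_def pA;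
  have [sY _] := lfsqrt_pos_def pA'.
set B := sqrt A in sB *; set Y := sqrt A' in sY *; set E := Y - B; set D := A' - A.
have sE : sa E by apply: self_adjointB.
have sD : sa D by apply: self_adjointB; [case: pA' | case: pA].
have DE : D = (Y \o E)%VF + (E \o B)%VF.
  rewrite /E !(comp_lfunDl, comp_lfunDr, comp_lfunNl, comp_lfunNr) addrA subrK.
  by rewrite !lfsqrtK //; apply: pos_def_semidef.
have trED : tr (E \o D)%VF = tr ((E \o E) \o Y)%VF + tr ((E \o E) \o B)%VF.
  by rewrite DE comp_lfunDr lftraceD !comp_lfunA [tr (E \o Y \o E)%VF]lftraceC
    comp_lfunA.
have low C : psd (C - delta *: \1%VF) -> delta * tr (E \o E)%VF <= tr ((E \o E) \o
  C)%VF.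
  move/(lftrace_mul_le (pos_semidef_sqr sE)).
  by rewrite -comp_lfunZr comp_lfun1r lftraceZ.
clearbody D E; have := lftrace_ge0 (pos_semidef_sqr (self_adjointB (self_adjointZ (2
  * delta) sE) sD)).
rewrite !(comp_lfunDl, comp_lfunDr, comp_lfunNl, comp_lfunNr).
rewrite -!comp_lfunZl -!comp_lfunZr !(lftraceD, lftraceN, lftraceZ) [tr (D \o
  E)%VF]lftraceC trED.
have := low _ (lfsqrt_ge_scalar pA pAd); have := low _ (lfsqrt_ge_scalar pA' pA'd).
rewrite -/B -/Y; set a := tr (_ \o Y)%VF; set b := tr (_ \o B)%VF.
set e := tr (E \o E)%VF; set d := tr (D \o D)%VF => ha hb h.
have : 0 <= delta * (a - delta * e) by rewrite mulr_ge0 ?subr_ge0 // ltW.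
have : 0 <= delta * (b - delta * e) by rewrite mulr_ge0 ?subr_ge0 // ltW.
move: h; rewrite expr2; lra.
Qed.

End TraceSqrt.

(** * The regularizer and its gradient *)

Section Regularizer.
Context {R : realType} {X : vectType R} (dot : {dot X for @idfun R}).
Implicit Types (A B P Q F D S : 'End(X)) (x y z v w m g h : X).
Local Notation sa := (self_adjoint dot).
Local Notation psd := (pos_semidef dot).
Local Notation pd := (pos_def dot).
Local Notation tr := lftrace.
Local Notation sqrt A := (lfsqrt dot A).

Lemma lfpowSr A k : lfpow A k.+1 = (lfpow A k \o A)%VF.
Proof.
elim: k => [|k IHk]; first by rewrite /lfpow /= comp_lfun1l comp_lfun1r.
by rewrite -[LHS]/(comp_lfun A (lfpow A k.+1)) {1}IHk comp_lfunA.
Qed.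

Variable H : {vspace 'End(X)}.
Hypothesis H_sa : forall A : 'End(X), A \in H -> sa A.
Hypothesis H_id : \1%VF \in H.
Hypothesis H_sandwich : forall A F : 'End(X), A \in H -> F \in H -> (A \o F \o A)%VF
  \in H.

(** Strong induction in steps of two, since [A^(k+2) = A A^k A] has the form that [H_sandwich]
    accepts. *)
Lemma memv_lfpow A k : A \in H -> lfpow A k \in H.
Proof.
move=> AH; have [n] := ubnP k; elim: n k => // n IHn [|[|k]] le_k; first by [].
  by rewrite /lfpow /= comp_lfun1r.
rewrite lfpowSr; apply: H_sandwich => //; apply: IHn.
by move: le_k; rewrite !ltnS => /ltnW.
Qed.

Lemma memv_sqrt A : A \in H -> pd A -> sqrt A \in H.
Proof.
by move=> AH /lfsqrt_lfpoly[p ->]; apply: memv_lfpoly => k; apply: memv_lfpow.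
Qed.

Lemma memv_inv A : A \in H -> pd A -> (A^-1)%VF \in H.
Proof.
by move=> AH /pos_def_inv_lfpoly[p ->]; apply: memv_lfpoly => k; apply: memv_lfpow.
Qed.

Hypothesis H_proj : forall A : 'End(X), pd A -> pd (proj dot H A).
Local Notation phi x := (proj dot H (out dot x)).

Variables (S : 'End(X)) (delta : R).
Hypotheses (delta_gt0 : 0 < delta) (SH : S \in H).
Hypothesis S_ge : psd (S - (delta ^+ 2) *: \1%VF).

Let phi_psd x : psd (phi x) := phi_pos_semidef H_sa H_id H_proj x.

Lemma ge_scalar_pos_def : pd S.
Proof.
rewrite -(subrK ((delta ^+ 2) *: \1%VF) S) addrC; apply: pos_defD => //.
by apply: pos_def_scalar; rewrite exprn_gt0.
Qed.

Lemma memv_phiD m : phi m + S \in H.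
Proof. by rewrite memvD ?memv_proj. Qed.

Lemma phiD_pos_def m : pd (phi m + S).
Proof. by rewrite addrC; apply: pos_defD => //; exact: ge_scalar_pos_def. Qed.

Lemma phiD_ge m : psd (phi m + S - (delta ^+ 2) *: \1%VF).
Proof. by rewrite -addrA; apply: pos_semidefD. Qed.

Lemma memv_sqrt_phiD m : sqrt (phi m + S) \in H.
Proof. by apply: memv_sqrt; [exact: memv_phiD | exact: phiD_pos_def]. Qed.

Lemma memv_sqrt_phiD_inv m : (sqrt (phi m + S))^-1%VF \in H.
Proof. by apply: memv_inv; [exact: memv_sqrt_phiD |
  exact/lfsqrt_pos_def/phiD_pos_def]. Qed.

Lemma lftrace_mul_phiB F x h : F \in H ->
  tr (F \o (phi (x + h) - phi x))%VF = 2 * dot (F h) x + dot (F h) h.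
Proof.
move=> FH; rewrite comp_lfunDr comp_lfunNr lftraceB !lftrace_phi // (linearD F) !dotE
  /=.
by rewrite (H_sa FH x h) [dot x _]dotC; ring.
Qed.

(** In [lftrace_sqrtE], half of the first-order trace is [<B^-1 h, m> + <B^-1 h, h> / 2]. What
    remains beside the linear term is bounded by a multiple of [|h|^2]. *)
Lemma sqrt_phiD_gradient m :
  is_gradient dot (fun m => tr (sqrt (phi m + S))) m ((sqrt (phi m + S))^-1%VF m).
Proof.
(* The first summand covers [<B^-1 h, h>]; the second covers the remainder, combining
   [B^-1 <= delta^-1] with the Lipschitz bounds for the square root and for [phi]. *)
pose c := delta^-1 + delta^-1 ^+ 3 * (6 * dot m m + 3).
have c_gt0 : 0 < c.
  by rewrite ltr_pwDl ?invr_gt0 // mulr_ge0 ?exprn_ge0 ?invr_ge0 ?ltW // ltr_wpDl //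
    mulr_ge0 ?dot_ge0.
(* The radius 1 is the range of [lftrace_sqr_phiB]; the radius [e / c] turns [c |h|^2] into at most
   [e |h|]. *)
move=> e e_gt0; exists (Num.min 1 (e / c)); first by rewrite lt_min ltr01 divr_gt0.
move=> h; rewrite lt_min => /andP[h_lt1 h_lte].
have hh : dot h h = enorm dot h ^+ 2 by rewrite sqr_sqrtr ?dot_ge0.
have h_ge0 : 0 <= enorm dot h by apply: sqrtr_ge0.
have hh_le1 : dot h h <= 1 by rewrite hh expr_le1 // ltW.
suff : `|tr (sqrt (phi (m + h) + S)) - tr (sqrt (phi m + S)) - dot ((sqrt (phi m +
  S))^-1%VF m) h|
    <= c * dot h h.
  move=> /le_trans; apply; rewrite hh expr2 mulrA ler_wpM2r // mulrC.
  by rewrite -ler_pdivlMr // ltW.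
have [pA pA'] := (phiD_pos_def m, phiD_pos_def (m + h)).
rewrite (lftrace_sqrtE pA (pos_def_semidef pA')).
have -> : phi (m + h) + S - (phi m + S) = phi (m + h) - phi m.
  by rewrite opprD addrACA subrr addr0.
rewrite lftrace_mul_phiB ?memv_sqrt_phiD_inv //.
have := lftrace_sqr_phiB H_sa m hh_le1.
have := lftrace_sqr_sqrtB_le delta_gt0 pA pA' (phiD_ge m) (phiD_ge (m + h)).
have -> : phi (m + h) + S - (phi m + S) = phi (m + h) - phi m.
  by rewrite opprD addrACA subrr addr0.
set E := sqrt (phi (m + h) + S) - sqrt (phi m + S) => trE trD.
have sE : sa E by apply: self_adjointB; case: (lfsqrt_pos_def pA) (lfsqrt_pos_def
  pA') => + _ [].
have pBi := pos_def_inv (lfsqrt_pos_def pA).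
have pEE := pos_semidef_sqr sE.
have dBi := lfsqrt_inv_le_scalar delta_gt0 pA (phiD_ge m).
have EE_ge0 := lftrace_mul_ge0 (pos_def_semidef pBi) pEE.
have : tr ((sqrt (phi m + S))^-1 \o (E \o E))%VF <= delta^-1 * tr (E \o E)%VF.
  rewrite lftraceC; apply: le_trans (lftrace_mul_le pEE dBi) _.
  by rewrite -comp_lfunZr comp_lfun1r lftraceZ.
have [sBi qBi] := pos_def_semidef pBi.
have := qBi h; have [_ /(_ h)] := dBi.
rewrite add_lfunE opp_lfunE scale_lfunE id_lfunE !dotE => h1 h2 h3.
have -> : dot ((sqrt (phi m + S))^-1%VF h) m = dot ((sqrt (phi m + S))^-1%VF m) h.
  by rewrite sBi dotC.
move: h1 h2 h3 EE_ge0 (le_trans trE trD) (dot_ge0 dot h) (dot_ge0 dot m); rewrite /c.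
set t := tr (sqrt _); set u := dot _ h; set r := dot _ h.
set e2 := tr (E \o E)%VF; set w := tr (_ \o _)%VF; set q := dot h h; set s := dot m m.
set i := delta^-1 => h1 h2 h3 w0 he q0 s0.
have i_gt0 : 0 < i by rewrite invr_gt0.
have he' : 4 * e2 <= i ^+ 2 * ((6 * s + 3) * q).
  have := ler_wpM2l (sqr_ge0 i) he; have -> : i ^+ 2 * (4 * delta ^+ 2 * e2) = 4 * e2
    * (delta * i) ^+ 2 by ring.
  by rewrite divff ?gt_eqF // expr1n mulr1.
have := ler_wpM2l (ltW i_gt0) he'.
have p_ge0 : 0 <= i ^+ 3 * ((6 * s + 3) * q).
  by rewrite mulr_ge0 ?exprn_ge0 ?(ltW i_gt0) // mulr_ge0 // addr_ge0 // mulr_ge0.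
have -> : i * (i ^+ 2 * ((6 * s + 3) * q)) = i ^+ 3 * ((6 * s + 3) * q) by ring.
have -> : (i + i ^+ 3 * (6 * s + 3)) * q = i * q + i ^+ 3 * ((6 * s + 3) * q) by ring.
move: p_ge0; set p := i ^+ 3 * _ => p0 hp.
have iq0 : 0 <= i * q by rewrite mulr_ge0 // ltW.
by rewrite ler_norml; lra.
Qed.

End Regularizer.

(** * Uniqueness and scaling of gradients *)

Section Gradient.
Context {R : realType} {X : vectType R} (dot : {dot X for @idfun R}).

Lemma enormZ (a : R) (x : X) : 0 <= a -> enorm dot (a *: x) = a * enorm dot x.
Proof.
move=> a0; rewrite /enorm !dotE mulrA sqrtrM ?mulr_ge0 //.
by rewrite -expr2 sqrtr_sqr ger0_norm.
Qed.

(** Two gradients [w], [v] are compared along [t u] with [u = w - v]. The choice of [e] yields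
    [t |u|^2 <= 2 e |t u| = t |u|^2 / 2], which is absurd for nonzero [u]. *)
Lemma gradientP (f : X -> R) m v : is_gradient dot f m v -> gradient dot f m = v.
Proof.
move=> fv; have fw : is_gradient dot f m (gradient dot f m).
  by apply: (@xgetPex _ 0 [set v : X | is_gradient dot f m v]%classic); exists v.
set w := gradient dot f m in fw *; apply/eqP; rewrite -subr_eq0.
apply/negPn/negP => u0; set u := w - v in u0.
have uu_gt0 := dot_gt0 dot u0; have n_gt0 : 0 < enorm dot u by rewrite sqrtr_gt0.
have uu : dot u u = enorm dot u ^+ 2 by rewrite sqr_sqrtr // ltW.
pose e := enorm dot u / 4; have e_gt0 : 0 < e by rewrite divr_gt0.
have [d1 d1_gt0 hv] := fv e e_gt0; have [d2 d2_gt0 hw] := fw e e_gt0.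
pose d := Num.min d1 d2; have d_gt0 : 0 < d by rewrite lt_min d1_gt0.
pose t := d / (2 * enorm dot u); have t_gt0 : 0 < t by rewrite divr_gt0 // mulr_gt0.
have tu : enorm dot (t *: u) = d / 2.
  by rewrite enormZ ?ltW // /t; field; rewrite gt_eqF.
have lt_d : d / 2 < d by rewrite ltr_pdivrMr // ltr_pMr // ltr1n.
have := hv (t *: u); rewrite tu => /(_ (lt_le_trans lt_d _));
  rewrite ge_min lexx => /(_ isT).
have := hw (t *: u); rewrite tu => /(_ (lt_le_trans lt_d _));
  rewrite ge_min lexx orbT => /(_ isT).
rewrite !ler_norml !dotZr => /andP[hw1 _] /andP[_ hv2].
have : t * dot u u <= 2 * (e * (d / 2)).
  rewrite {1}/u dotDl dotNl; move: hw1 hv2; lra.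
have -> : 2 * (e * (d / 2)) = t * dot u u / 2.
  by rewrite uu /e /t; field; rewrite gt_eqF.
have : 0 < t * dot u u by rewrite mulr_gt0.
lra.
Qed.

Lemma is_gradientZ (f : X -> R) m v (a : R) : 0 < a -> is_gradient dot f m v ->
  is_gradient dot (fun x => a * f x) m (a *: v).
Proof.
move=> a0 fv e e0; have [d d0 hd] := fv (e / a) (divr_gt0 e0 a0).
exists d => // h /hd; rewrite dotZl -!mulrBr normrM gtr0_norm // mulrAC.
by rewrite ler_pdivlMr // mulrC.
Qed.

End Gradient.

(** * The operator norm of a self-adjoint operator *)

Section OpNorm.
Context {R : realType} {X : vectType R} (dot : {dot X for @idfun R}).

Lemma op_norm_bound (A : 'End(X)) x : self_adjoint dot A ->
  enorm dot (A x) <= op_norm dot A * enorm dot x.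
Proof.
move=> sA; have [->|x0] := eqVneq x 0.
  by rewrite linear0 /enorm !dot0l sqrtr0 mulr0.
have n_gt0 : 0 < enorm dot x by rewrite sqrtr_gt0 dot_gt0.
have v_ge0 : 0 <= (enorm dot x)^-1 by rewrite invr_ge0 ltW.
rewrite -ler_pdivrMr // mulrC -enormZ // -linearZ /=.
apply: ub_le_sup; last first.
  exists ((enorm dot x)^-1 *: x) => //=.
  by rewrite enormZ // mulVf // gt_eqF.
(* A finite upper bound on the unit ball, so that the real [sup] is a true supremum. *)
exists (Num.sqrt (lftrace (A \o A)%VF)) => _ [y /= y_le1 <-].
rewrite ler_wsqrtr // -sA -comp_lfunE.
apply: le_trans (pos_semidef_le_lftrace y (pos_semidef_sqr sA)) _.
rewrite -[leRHS]mulr1 ler_wpM2l ?(lftrace_ge0 (pos_semidef_sqr sA)) //.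
by rewrite -(sqr_sqrtr (dot_ge0 dot y)) expr_le1 ?sqrtr_ge0.
Qed.

End OpNorm.

(** * Lower bound and one-step increase of the potential *)

Section Step.
Context {R : realType} {X : vectType R} (dot : {dot X for @idfun R}).
Implicit Types (A B P Q F D S E : 'End(X)) (x y z v w m g h : X).
Local Notation sa := (self_adjoint dot).
Local Notation psd := (pos_semidef dot).
Local Notation pd := (pos_def dot).
Local Notation tr := lftrace.
Local Notation sqrt A := (lfsqrt dot A).

Variable H : {vspace 'End(X)}.
Hypothesis H_sa : forall A : 'End(X), A \in H -> sa A.
Hypothesis H_id : \1%VF \in H.
Hypothesis H_sandwich : forall A F : 'End(X), A \in H -> F \in H -> (A \o F \o A)%VF
  \in H.
Hypothesis H_proj : forall A : 'End(X), pd A -> pd (proj dot H A).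
Local Notation phi x := (proj dot H (out dot x)).

(** Squares [|sqrt (phi x) z| <= r |z|], whose left side squared is [<phi x z, z>]. *)
Lemma phi_le_rho r x : rho dot H x <= r -> psd ((r ^+ 2) *: \1%VF - phi x).
Proof.
move=> rx; have px := phi_pos_semidef H_sa H_id H_proj x.
have [sC _] := lfsqrt_pos_semidef px; split=> [|z].
  by apply: self_adjointB; [exact/self_adjointZ/self_adjoint1 | case: px].
rewrite add_lfunE opp_lfunE scale_lfunE id_lfunE dotDl dotNl dotZl subr_ge0.
rewrite -{1}(lfsqrtK px) comp_lfunE sC.
rewrite -(sqr_sqrtr (dot_ge0 dot (sqrt (phi x) z))) -(sqr_sqrtr (dot_ge0 dot z))
  -exprMn.
have le_rz : enorm dot (sqrt (phi x) z) <= r * enorm dot z.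
  by apply: le_trans (op_norm_bound z sC) _; rewrite ler_wpM2r ?sqrtr_ge0.
by rewrite ler_sqr ?nnegrE ?sqrtr_ge0 // (le_trans _ le_rz) ?sqrtr_ge0.
Qed.

(* The trace form of [phi (A^(-1/2) x) <= \1]. *)
Lemma dot_sqrt_inv_le A E x : A \in H -> pd A -> psd (A - phi x) -> E \in H -> psd E
  ->
  dot (E ((sqrt A)^-1%VF x)) ((sqrt A)^-1%VF x) <= tr E.
Proof.
move=> AH pA pAx EH pE; have pB := lfsqrt_pos_def pA; set V := (sqrt A)^-1%VF.
have VH : V \in H by apply: (memv_inv (dot := dot)) => //; apply: memv_sqrt.
have sV : sa V := H_sa VH.
have -> : dot (E (V x)) (V x) = dot ((V \o E \o V)%VF x) x by rewrite !comp_lfunE sV.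
rewrite -(lftrace_phi H_sa) //; last exact: H_sandwich.
apply: le_trans (lftrace_mul_le (pos_semidef_sandwich sV pE) pAx) _.
rewrite -{1}(lfsqrtK (pos_def_semidef pA)) -!comp_lfunA [(V \o (sqrt A \o
  _))%VF]comp_lfunA.
by rewrite (pos_defVf pB) comp_lfun1l lftraceC -comp_lfunA (pos_deffV pB) comp_lfun1r.
Qed.

(** With [B] the root of [phi m + S], apply AM-GM in the form of [B] to [- r B^-1 m] and [y]. Both
    squares are at most [r^2 tr B]: the first by [dot_sqrt_inv_le], the second because
    [<B y, y> = tr (B phi y)] and [phi y <= r^2]. *)
Lemma potential_ge_dot S (delta r : R) m y : 0 < delta -> S \in H ->
  psd (S - (delta ^+ 2) *: \1%VF) -> 0 < r -> rho dot H y <= r ->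
  - dot m y <= r * tr (sqrt (phi m + S)).
Proof.
move=> d0 SH S_ge r0 /phi_le_rho ry.
have pA := phiD_pos_def H_sa H_id H_proj d0 S_ge m.
have AH := memv_phiD H_sa SH m; have BH := memv_sqrt_phiD H_sa H_id H_sandwich H_proj
  d0 SH S_ge m.
have pB := lfsqrt_pos_def pA; have psB := pos_def_semidef pB.
have le_u : dot (sqrt (phi m + S) ((sqrt (phi m + S))^-1%VF m)) ((sqrt (phi m +
  S))^-1%VF m) <= tr (sqrt (phi m + S)).
  apply: dot_sqrt_inv_le => //; rewrite addrAC subrr add0r.
  exact/pos_def_semidef/(ge_scalar_pos_def d0 S_ge).
have le_y : dot (sqrt (phi m + S) y) y <= r ^+ 2 * tr (sqrt (phi m + S)).
  rewrite -(lftrace_phi H_sa) //; apply: le_trans (lftrace_mul_le psB ry) _.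
  by rewrite -comp_lfunZr comp_lfun1r lftraceZ.
have := pos_semidef_AMGM ((- r) *: ((sqrt (phi m + S))^-1%VF m)) y psB.
rewrite linearZ !dotE /= (pos_defVK m pB) in le_u *.
move: le_u le_y; set t := tr _; set u := dot m _; set w := dot _ y; set a := dot m y.
move=> le_u le_y le_a; have : r * u <= r * t by rewrite ler_pM2l.
have := ler_wpM2l (sqr_ge0 r) le_u => h1 h2.
suff : r * (- a) <= r * (r * t) by rewrite ler_pM2l.
lra.
Qed.

(** Let [r = tr B' - tr B] and [q = <B'^-1 g, g>]. Concavity at [A'] and the bound [r] on the cross
    term give at most [2 r + q / 2], which is at most [5 q / 2] as [r <= q]. Finally
    [q <= <S'^(-1/2) g, g>], and concavity at [S'] bounds the latter by twice the increase of the
    trace; this is where 5 arises. *)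
Lemma potential_step S (delta : R) m g : 0 < delta -> S \in H ->
  psd (S - (delta ^+ 2) *: \1%VF) ->
  tr (sqrt (phi (m + g) + (S + phi g))) - tr (sqrt (phi m + S))
    - dot ((sqrt (phi m + S))^-1%VF m) g
  <= 5 * (tr (sqrt (S + phi g)) - tr (sqrt S)).
Proof.
move=> d0 SH S_ge; have phi_psd x := phi_pos_semidef H_sa H_id H_proj x.
have phiH x : phi x \in H by apply: memv_proj.
set S' := S + phi g; have S'H : S' \in H by rewrite memvD.
have S'_ge : psd (S' - (delta ^+ 2) *: \1%VF) by rewrite /S' addrAC;
  apply: pos_semidefD.
have pS := ge_scalar_pos_def d0 S_ge; have pS' := ge_scalar_pos_def d0 S'_ge.
have pA := phiD_pos_def H_sa H_id H_proj d0 S_ge m.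
have pA' := phiD_pos_def H_sa H_id H_proj d0 S'_ge m.
have pY := phiD_pos_def H_sa H_id H_proj d0 S'_ge (m + g).
have AH := memv_phiD H_sa SH m; have A'H := memv_phiD H_sa S'H m.
have BH := memv_sqrt_phiD H_sa H_id H_sandwich H_proj d0 SH S_ge m.
have B'H := memv_sqrt_phiD H_sa H_id H_sandwich H_proj d0 S'H S'_ge m.
have pB := lfsqrt_pos_def pA; have pB' := lfsqrt_pos_def pA'.
have V'H := memv_sqrt_phiD_inv H_sa H_id H_sandwich H_proj d0 S'H S'_ge m.
have TH : (sqrt S')^-1%VF \in H.
  by apply: (memv_inv (dot := dot)) => //; [exact: memv_sqrt | exact: lfsqrt_pos_def].
have A'A : (phi m + S') - (phi m + S) = phi g.
  by rewrite opprD addrACA subrr add0r /S' addrAC subrr add0r.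
have pA'A : psd ((phi m + S') - (phi m + S)) by rewrite A'A.
have concave_Y := lftrace_sqrt_concave pA' (pos_def_semidef pY).
rewrite [X in (_ \o X)%VF](_ : _ = phi (m + g) - phi m) in concave_Y; last first.
  by rewrite opprD addrACA subrr addr0.
rewrite lftrace_mul_phiB // in concave_Y.
have concave_S := lftrace_sqrt_concave pS' (pos_def_semidef pS).
rewrite [X in (_ \o X)%VF](_ : _ = - phi g) in concave_S; last first.
  by rewrite /S' opprD addrA subrr add0r.
rewrite comp_lfunNr lftraceN lftrace_phi // in concave_S.
have le_r := lftrace_sqrtB_le pA pA'A; rewrite A'A lftrace_phi // in le_r.
have [_ /(_ g)] : psd ((sqrt S')^-1%VF - (sqrt (phi m + S'))^-1%VF).
  by apply: lfsqrt_inv_antitone => //; rewrite addrK.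
rewrite add_lfunE opp_lfunE dotDl dotNl => le_q.
have pE := lfsqrt_monotone pA pA'A.
have EH : sqrt (phi m + S') - sqrt (phi m + S) \in H by rewrite memvB.
(* The bounds [le_u] and [le_v] rest on [phi m <= phi m + S] and [phi g <= phi m + S']. *)
have le_u : dot ((sqrt (phi m + S') - sqrt (phi m + S)) ((sqrt (phi m + S))^-1%VF m))
    ((sqrt (phi m + S))^-1%VF m) <= tr (sqrt (phi m + S')) - tr (sqrt (phi m + S)).
  rewrite -lftraceB; apply: dot_sqrt_inv_le => //.
  by rewrite addrAC subrr add0r; apply: pos_def_semidef.
have le_v : dot ((sqrt (phi m + S') - sqrt (phi m + S)) ((sqrt (phi m + S'))^-1%VF g))
    ((sqrt (phi m + S'))^-1%VF g) <= tr (sqrt (phi m + S')) - tr (sqrt (phi m + S)).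
  rewrite -lftraceB; apply: dot_sqrt_inv_le => //.
  by rewrite /S' addrA addrK; apply: pos_def_semidef.
(* The minus sign on the second vector makes AM-GM bound the cross term from above. *)
have := pos_semidef_AMGM ((sqrt (phi m + S'))^-1%VF g) (- ((sqrt (phi m + S))^-1%VF
  m)) pE.
have lfunN (F : 'End(X)) z : F (- z) = - F z by rewrite linearN.
rewrite lfunN !dotNr dotNl opprK.
rewrite [X in 2 * (- X)](_ : _ = dot ((sqrt (phi m + S))^-1%VF m) g - dot ((sqrt (phi
  m + S'))^-1%VF g) m).
  move=> le_uv; lra.
rewrite add_lfunE opp_lfunE dotDl dotNl (pos_defVK g pB') [dot g _]dotC;
  congr (_ - _).
by rewrite (proj1 pB) (pos_defVK m pB).
Qed.

End Step.

(** * Regret of the algorithm *)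

Section Regret.
Context {R : realType} {X : vectType R} (dot : {dot X for @idfun R}).
Local Notation psd := (pos_semidef dot).
Local Notation pd := (pos_def dot).
Local Notation tr := lftrace.
Local Notation sqrt A := (lfsqrt dot A).

Variable H : {vspace 'End(X)}.
Hypothesis H_sa : forall A : 'End(X), A \in H -> self_adjoint dot A.
Hypothesis H_id : \1%VF \in H.
Hypothesis H_sandwich : forall A F : 'End(X), A \in H -> F \in H -> (A \o F \o A)%VF
  \in H.
Hypothesis H_proj : forall A : 'End(X), pd A -> pd (proj dot H A).
Local Notation phi x := (proj dot H (out dot x)).

Variables (eta delta : R) (g : nat -> X).
Hypotheses (eta_gt0 : 0 < eta) (delta_gt0 : 0 < delta).
Local Notation S k := (leon_S dot delta H g k).
Local Notation m k := (leon_m g k).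
Local Notation x k := (leon_x dot eta delta H g k).
Local Notation psi k := (tr (sqrt (phi (m k) + S k))).

Lemma memv_leon_S k : S k \in H.
Proof.
by elim: k => [|k IHk] /=; [rewrite memvZ | rewrite memvD // memv_proj].
Qed.

Lemma leon_S_ge k : psd (S k - (delta ^+ 2) *: \1%VF).
Proof.
elim: k => [|k IHk] /=; first by rewrite subrr; apply: pos_semidef0.
by rewrite addrAC; apply: pos_semidefD => //; apply: phi_pos_semidef.
Qed.

(** The initial point fits the formula because [leon_m g 0 = 0]. For later points, the trace norm in
    [leon_Psi] is a plain trace and its gradient is known. *)
Lemma leon_xE k : x k = - (eta *: (sqrt (phi (m k) + S k))^-1%VF (m k)).
Proof.
case: k => [|k]; first by rewrite /= linear0 scaler0 oppr0.
rewrite [LHS]/=; congr (- _); apply: gradientP.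
have -> : leon_Psi dot eta H (S k.+1) = fun z => eta * tr (sqrt (phi z + S k.+1)).
  apply/funext => z; rewrite /leon_Psi trace_norm_pos_semidef //.
  exact/pos_def_semidef/(phiD_pos_def H_sa H_id H_proj delta_gt0 (leon_S_ge k.+1)).
apply: is_gradientZ => //.
exact: (sqrt_phiD_gradient H_sa H_id H_sandwich H_proj delta_gt0 (memv_leon_S k.+1)
  (leon_S_ge k.+1)).
Qed.

(** By [leon_xE], [<g_k, x_k>] is [- eta] times the linear term of [potential_step], so that
    inequality telescopes. *)
Lemma leon_sum_le K :
  \sum_(k < K) dot (g k) (x k) + eta * psi K
  <= eta * (5 * (tr (sqrt (S K)) - tr (sqrt (S 0))) + psi 0).
Proof.
elim: K => [|K IHK].
  by rewrite big_ord0 add0r subrr mulr0 add0r.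
rewrite big_ord_recr leon_xE /= dotNr dotZr.
have /(ler_wpM2l (ltW eta_gt0)) := potential_step H_sa H_id H_sandwich H_proj (m K)
  (g K) delta_gt0 (memv_leon_S K) (leon_S_ge K).
rewrite [dot _ (g K)]dotC; move: IHK; lra.
Qed.

Lemma leon_m_sum K : m K = \sum_(k < K) g k.
Proof. by elim: K => [|K IHK]; rewrite ?big_ord0 // big_ord_recr /= IHK. Qed.

(** The comparator contributes [- <m, y>], which [potential_ge_dot] with radius [eta] bounds by the
    term [eta * psi K] of [leon_sum_le]. As [phi 0 = 0], the starting value [psi 0] is
    [tr (sqrt (S 0))], absorbed by the negative end of the telescoped sum. *)
Lemma leon_regret_le K y : rho dot H y <= eta ->
  \sum_(k < K) dot (g k) (x k - y) <= 5 * (eta * tr (sqrt (S K))).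
Proof.
move=> ry; have -> : \sum_(k < K) dot (g k) (x k - y) =
    \sum_(k < K) dot (g k) (x k) - dot (m K) y.
  rewrite leon_m_sum -applyrE (linear_sum (applyr dot y)) -sumrB.
  by apply: eq_bigr => k _; rewrite dotDr dotNr.
have := potential_ge_dot H_sa H_id H_sandwich H_proj (m K) delta_gt0 (memv_leon_S K)
  (leon_S_ge K) eta_gt0 ry.
have := leon_sum_le K; rewrite [m 0]/= phi0 // add0r.
have : 0 <= eta * tr (sqrt (S 0)).
  apply: mulr_ge0 (ltW eta_gt0) _; apply: (lftrace_ge0 (dot := dot));
    apply: lfsqrt_pos_semidef.
  exact/pos_def_semidef/(ge_scalar_pos_def delta_gt0 (leon_S_ge 0)).
lra.
Qed.

End Regret.

Theorem theorem3 (R : realType) :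
  exists C : R, 0 < C /\
  forall (X : vectType R) (dot : {dot X for @idfun R})
    (H : {vspace 'End(X)})
    (H_sa : forall A : 'End(X), A \in H -> self_adjoint dot A)
    (H_id : \1%VF \in H)
    (H_sandwich : forall A F : 'End(X),
        A \in H -> F \in H -> (A \o F \o A)%VF \in H)
    (H_proj : forall A : 'End(X), pos_def dot A -> pos_def dot (proj dot H A))
    (Rad eta delta : R) (K : nat) (g : nat -> X),
    0 < Rad -> eta = Rad -> 0 < delta ->
    (regret dot (rho_ball dot H Rad) g (leon_x dot eta delta H g) K
     <= (C * (delta * Rad * (\dim (@fullv R X))%:R
              + Rad * rho_star dot H (g 0%N)
              + Rad * trace_norm dot (lfsqrt dot (leon_S dot delta H g K.+1))))%:E)%E.
Proof.
exists 5; split=> // X dot H H_sa H_id H_sandwich H_proj Rad eta delta K g Rad_gt0 ->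
  delta_gt0.
apply: ge_ereal_sup => _ [y ry <-]; rewrite lee_fin.
(* The [K.+1] rounds end at index [K.+1] of [leon_S], which is the operator S_K. The other two terms
   of the bound are nonnegative. *)
apply: le_trans (leon_regret_le H_sa H_id H_sandwich H_proj g Rad_gt0 delta_gt0 K.+1
  ry) _.
have psd_g := phi_pos_semidef H_sa H_id H_proj (g 0%N).
have psd_S := pos_def_semidef (ge_scalar_pos_def delta_gt0 (leon_S_ge H_sa H_id
  H_proj delta g K.+1)).
rewrite /rho_star !trace_norm_pos_semidef // ler_pM2l // lerDr addr_ge0 ?mulr_ge0
  ?(ltW Rad_gt0) ?(ltW delta_gt0) ?ler0n //.
exact/(lftrace_ge0 (dot := dot))/lfsqrt_pos_semidef.
Qed.
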